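(* Let $B$ be a finite ring with $2\in B^\times$, having an involution $*$ and a primitive group homomorphism $\beta:B^+\to\mathbb{C}^\times$ such that $\beta(b+b^* )=1$ for all $b\in B$. Let $m=2n\ge2$ be even and suppose $T\in\mathrm{GL}(m,B)$ satisfies $T^*=-T$. Then $$\sum_{b\in B^m}\beta(b^*Tb)=\mu(-T^{-1})|B|^n=\mu(T)|B|^n.$$
   Context: Rings have identity $1\ne0$ and need not be commutative; an involution is an antiautomorphism of order 1 or 2, extended to $M(m,B)$ by $(x^* )_{ij}=(x_{ji})^*$. $\beta$ is primitive if its kernel contains no right ideal of $B$ other than $(0)$. $B^m$ is the space of column vectors, and $b^*$ denotes the row vector $(b_1^*,\dots,b_m^* )$. Let $I\subset B^m\setminus\{0\}$ contain exactly one element of each set $\{v,-v\}$, $0\neq v\in B^m$. For $Y\in\mathrm{GL}(m,B)$ put $I_Y=\{v\in I:Yv\in-I\}$ and $\mu(Y)=(-1)^{|I_Y|}$; $\mu$ is a group homomorphism $\mathrm{GL}(m,B)\to\{1,-1\}$ independent of the choice of $I$. *)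

(* Defs.v *)
From HB Require Import structures.
From mathcomp Require Import all_boot all_order all_algebra.
From mathcomp Require Import reals complex.

Set Implicit Arguments.
Unset Strict Implicit.
Unset Printing Implicit Defensive.

Import GRing.Theory.

Local Open Scope ring_scope.

(* [star 1 = 1] follows from these axioms, since [star] is bijective. *)
Definition ring_involution (B : pzRingType) (star : B -> B) : Prop :=
  [/\ {morph star : x y / x + y},
      {morph star : x y / x * y >-> y * x}
    & involutive star].

Definition star_mx (B : pzRingType) (star : B -> B) (m n : nat)
    (A : 'M[B]_(m, n)) : 'M[B]_(n, m) :=
  \matrix_(i, j) star (A j i).

Definition additive_character (B : pzRingType) (C : unitRingType)
    (beta : B -> C) : Prop :=
  (forall b, beta b \is a GRing.unit) /\ {morph beta : x y / x + y >-> x * y}.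

Definition right_ideal (B : finPzRingType) (J : {set B}) : Prop :=
  [/\ 0 \in J,
      forall x y, x \in J -> y \in J -> x - y \in J
    & forall x b, x \in J -> x * b \in J].

Definition primitive_character (B : finPzRingType) (C : unitRingType)
    (beta : B -> C) : Prop :=
  forall J : {set B}, right_ideal J -> (forall x, x \in J -> beta x = 1) ->
    J = [set 0].

(* Library [unitmx] and [invmx] need commutative coefficients. *)
Definition mutually_inverse_mx (B : pzRingType) (m : nat) (Y Z : 'M[B]_m) :
    Prop :=
  Y *m Z = 1%:M /\ Z *m Y = 1%:M.

Definition half_system (B : finPzRingType) (m : nat) (I : {set 'cV[B]_m}) :
    Prop :=
  0 \notin I /\ forall v : 'cV[B]_m, v != 0 -> #|I :&: [set v; - v]| = 1%N.

(* The sign character of GL(m, B) computed from the half-system [I]; values at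
   non-invertible matrices are irrelevant. *)
Definition mu (B : finPzRingType) (m : nat) (I : {set 'cV[B]_m})
    (Y : 'M[B]_m) : int :=
  (-1) ^+ #|[set v in I | Y *m v \in [set - w | w in I]]|.

(* Main.v *)
Require Import Defs.
From HB Require Import structures.
From mathcomp Require Import all_boot all_order all_algebra.
From mathcomp Require Import all_fingroup pgroup.
From mathcomp Require Import reals complex ring zify.

Set Implicit Arguments.
Unset Strict Implicit.
Unset Printing Implicit Defensive.

Import GRing.Theory Num.Theory.
Local Open Scope ring_scope.

(** Put [c x y = beta (x^* T y)]. As [T] is skew and [beta (- star b) = beta b],
    this is a symmetric bicharacter of the group [V = B^m], whose order [N] is
    odd; primitivity of [beta] and invertibility of [T] make it nondegenerate,
    and the sum to be computed is the Gauss sum [G = \sum_x c x x].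

    Forms are compared through determinants of matrices indexed by [V]. Let
    [M = (c x y)], [F = (c x y ^ 2)] and [D] the diagonal matrix of the
    [c x x]. Completing the square gives [F D F = G D^-1 F' D^-1], where [F']
    is [F] with its columns permuted by negation. Since [F] is [M] with its
    columns permuted by doubling and [det D ^ 3 = 1], taking determinants yields
    [det M * sgn(2) = G ^ N * sgn(-1)] ([det_form]). If [c2 x y = c1 x (f y)],
    then [det M2 = det M1 * sgn(f)], hence [G2 ^ N = G1 ^ N * sgn(f)]
    ([gauss_sum_comp]).

    To take the [N]-th root, let [N = s ^ 2]. Orthogonality of characters says
    that [(M / s) ^ 2] is the matrix of negation, so [M / s] has order dividing
    4 and its trace [G / s] is a Gaussian integer ([gauss_sum_gaussian]). If
    moreover [(G / s) ^ N] is a sign, then [G / s] is a unit of [Z[i]], and since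
    [N] is odd it equals that sign ([gauss_sum_eval]).

    The base point is the standard symplectic matrix [J]: its Gauss sum is
    [|B|^n] by direct summation, and the form of [T] is the form of [J] composed
    with [- J T]. The sign of [J] as a permutation of [V] is [1], since [J] is a
    product of unipotent matrices that are squares; so [- 1 = J ^ 2] has sign
    [1] too. It remains to know that [mu] is the sign of a matrix acting as a
    permutation of [V]; this is a statement on permutations commuting with
    negation ([odd_perm_half]), proved by cancelling one sign change at a
    time. *)

(** * Traces of matrices of order dividing four *)

Section TraceOrderFour.
Variable C : numClosedFieldType.

(** For a full rank factorization [P = X Y], idempotence means [Y X = 1]. *)
Lemma mxtrace_idempotent (n : nat) (P : 'M[C]_n) :
  P *m P = P -> \tr P = (\rank P)%:R.
Proof.
have base := mulmx_base P; have /row_fullP[L LX] := col_base_full P.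
have /row_freeP[K YK] := row_base_free P; move: base L LX K YK.
move: (col_base P) (row_base P) => X Y XY L LX K YK idP.
suff YX : Y *m X = 1%:M by rewrite -[P in LHS]XY mxtrace_mulC YX mxtrace1.
have XYXY : X *m Y *m (X *m Y) = X *m Y by rewrite XY.
have /(congr1 (fun Z => L *m Z *m K)) := XYXY.
rewrite -!mulmxA YK !mulmx1 LX => h.
by rewrite -h mulmxA LX mul1mx.
Qed.

(** A quarter of this sum is the projector onto the fixed space of [E]. *)
Lemma mxtrace_order4_average (n : nat) (E : 'M[C]_n) :
  E ^+ 4 = 1 ->
  exists r : nat, \tr (1 + E + E ^+ 2 + E ^+ 3) = 4 * r%:R.
Proof.
move=> E4; set S := 1 + E + _ + _.
have ES : E * S = S.
  by rewrite /S !mulrDr mulr1 -expr2 -!exprS E4 addrC !addrA.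
have SS : S * S = 4%:R *: S.
  rewrite {1}/S !mulrDl mul1r ES !exprS expr0 mulr1 -!mulrA !ES.
  by rewrite -!mulr2n -mulrSr -mulrSr scaler_nat.
exists (\rank (4%:R^-1 *: S)); rewrite -mxtrace_idempotent.
  by rewrite mxtraceZ mulrA divff ?mul1r // pnatr_eq0.
rewrite -scalemxAl -scalemxAr -[S *m S]/(S * S) SS !scalerA.
by rewrite -mulrA mulVf ?mulr1 // pnatr_eq0.
Qed.

(** Averaging the twists [w E] with [w ^ 4 = 1] computes the multiplicities of
    the four possible eigenvalues; their differences give the two integer
    coordinates of the trace. *)
Lemma mxtrace_order4 (n : nat) (E : 'M[C]_n) :
  E ^+ 4 = 1 -> exists a b : int, \tr E = a%:~R + 'i * b%:~R.
Proof.
move=> E4.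
have exprZ (w : C) k : (w *: E) ^+ k = w ^+ k *: E ^+ k.
  elim: k => [|k IH]; first by rewrite !expr0 scale1r.
  rewrite !exprS IH -[LHS]/(w *: E *m (w ^+ k *: E ^+ k)).
  by rewrite -scalemxAl -scalemxAr scalerA.
have tw (w : C) : w ^+ 4 = 1 -> exists r : nat,
    n%:R + w * \tr E + w ^+ 2 * \tr (E ^+ 2) + w ^+ 3 * \tr (E ^+ 3)
      = 4 * r%:R.
  move=> w4; have [|r] := @mxtrace_order4_average n (w *: E).
    by rewrite exprZ E4 w4 scale1r.
  by rewrite !exprZ !mxtraceD !mxtraceZ mxtrace1 => h; exists r.
have i2 : ('i : C) ^+ 2 = -1 by rewrite sqrCi.
have i4 : ('i : C) ^+ 4 = 1 by rewrite (exprM _ 2 2) i2 sqrrN expr1n.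
have [r0 h0] := tw 1 (expr1n _ _).
have [|r1 h1] := tw (-1); first by rewrite -signr_odd.
have [r2 h2] := tw 'i i4.
have [|r3 h3] := tw (- 'i); first by rewrite exprNn -signr_odd mul1r.
exists (r0%:Z - r1%:Z), (r3%:Z - r2%:Z).
move: h0 h1 h2 h3; rewrite !expr1n !rmorphB /= -!pmulrn.
set x := \tr E; set y := \tr (E ^+ 2); set z := \tr (E ^+ 3).
move=> h0 h1 h2 h3; apply: (@mulfI C 4); first by rewrite pnatr_eq0.
have -> : 4 * (r0%:R - r1%:R + 'i * (r3%:R - r2%:R)) =
  4 * r0%:R - 4 * r1%:R + 'i * (4 * r3%:R - 4 * r2%:R) :> C by ring.
rewrite -h0 -h1 -h2 -h3.
transitivity (2 * x + 2 * z - 2 * 'i ^+ 2 * x - 2 * 'i ^+ 4 * z : C); last by ring.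
by rewrite i2 i4; ring.
Qed.

(** Such a [u] has modulus 1, hence is one of the four units of [Z[i]]; as
    [u ^ (2 N) = 1] with [N] odd, it is a sign. *)
Lemma gaussian_unit_odd_power (u : C) (a b : int) (N : nat) :
  u = a%:~R + 'i * b%:~R -> odd N -> u ^+ N = 1 \/ u ^+ N = -1 -> u = u ^+ N.
Proof.
move=> uE oN uN.
have N0 : (0 < N)%N by case: N oN {uN}.
have uN2 : u ^+ N ^+ 2 = 1 by case: uN => ->; rewrite ?sqrrN expr1n.
have nu : `|u| = 1.
  apply/eqP; rewrite -(pexpr_eq1 N0) // -normrX.
  by case: uN => ->; rewrite ?normrN normr1.
have ab : a ^+ 2 + b ^+ 2 = 1.
  apply: (@intr_inj C); rewrite rmorphD !rmorphXn /=.
  by rewrite -normC2_rect ?realz // -uE nu expr1n.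
have i2 : ('i : C) ^+ 2 = -1 by rewrite sqrCi.
have u4 : u ^+ 4 = 1.
  have [a0 | b0] : a = 0 \/ b = 0 by nia.
  - have {}ab : b ^+ 2 = 1 by rewrite -ab a0 expr0n add0r.
    rewrite uE a0 add0r (exprM _ 2 2) (exprMn 2 'i) i2 -rmorphXn ab.
    by rewrite mulr1 sqrrN expr1n.
  - have {}ab : a ^+ 2 = 1 by rewrite -ab b0 expr0n addr0.
    by rewrite uE b0 mulr0 addr0 (exprM _ 2 2) -rmorphXn ab expr1n.
have u2 : u ^+ 2 = 1.
  move: uN2; rewrite -exprM -[N]odd_double_half oN mulnDl exprD.
  by rewrite -mul2n mulnAC (exprM u 4) u4 expr1n mulr1.
by rewrite -[N]odd_double_half oN exprD -mul2n exprM u2 expr1n mulr1.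
Qed.
End TraceOrderFour.

(** * Matrices indexed by a finite set and signs of maps *)

Section FunSign.
Variables (C : numClosedFieldType) (V : finType).
Implicit Types f g : V -> V.

Lemma sum_enum_val (F : V -> C) :
  \sum_(i < #|V|) F (enum_val i) = \sum_x F x.
Proof. by rewrite [RHS]big_enum_val. Qed.

Lemma prod_enum_val (F : V -> C) :
  \prod_(i < #|V|) F (enum_val i) = \prod_x F x.
Proof. by rewrite [RHS]big_enum_val. Qed.

Definition kernel_mx (k : V -> V -> C) : 'M[C]_#|V| :=
  \matrix_(i, j) k (enum_val i) (enum_val j).

Lemma eq_kernel_mx k l : (forall x y, k x y = l x y) -> kernel_mx k = kernel_mx l.
Proof. by move=> kl; apply/matrixP=> i j; rewrite !mxE. Qed.

Lemma mul_kernel_mx k l :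
  kernel_mx k *m kernel_mx l = kernel_mx (fun x z => \sum_y k x y * l y z).
Proof.
apply/matrixP=> i j; rewrite !mxE -sum_enum_val.
by apply: eq_bigr => h _; rewrite !mxE.
Qed.

Lemma mxtrace_kernel k : \tr (kernel_mx k) = \sum_x k x x.
Proof. by rewrite -sum_enum_val; apply: eq_bigr => i _; rewrite mxE. Qed.

Lemma kernel_mx1 : kernel_mx (fun x y => (x == y)%:R) = 1%:M.
Proof. by apply/matrixP=> i j; rewrite !mxE (inj_eq enum_val_inj). Qed.

Lemma det_kernel_scale a k b :
  \det (kernel_mx (fun x y => a x * k x y * b y)) =
  (\prod_x a x) * \det (kernel_mx k) * (\prod_x b x).
Proof.
rewrite -!prod_enum_val.
have -> : kernel_mx (fun x y => a x * k x y * b y) =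
    diag_mx (\row_i a (enum_val i)) *m kernel_mx k *m
    diag_mx (\row_i b (enum_val i)).
  apply/matrixP=> i j.
  by rewrite mul_mx_diag mul_diag_mx !mxE.
by rewrite !det_mulmx !det_diag; congr (_ * _ * _); apply: eq_bigr => i _;
  rewrite mxE.
Qed.

(** The sign of a map as the determinant of its matrix: unlike the parity of a
    permutation, it is multiplicative without carrying proofs of bijectivity. *)
Definition fun_sign f : C := \det (kernel_mx (fun x y => (x == f y)%:R)).

Lemma mul_kernel_fun k f :
  kernel_mx k *m kernel_mx (fun x y => (x == f y)%:R) =
  kernel_mx (fun x y => k x (f y)).
Proof.
rewrite mul_kernel_mx; apply: eq_kernel_mx => x z.
rewrite (bigD1 (f z)) //= eqxx mulr1 big1 ?addr0 // => y /negPf->.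
by rewrite mulr0.
Qed.

Lemma eq_fun_sign f g : f =1 g -> fun_sign f = fun_sign g.
Proof. by move=> fg; congr (\det _); apply: eq_kernel_mx => x y; rewrite fg. Qed.

Lemma fun_sign_id : fun_sign id = 1.
Proof. by rewrite /fun_sign kernel_mx1 det1. Qed.

Lemma fun_sign_comp f g : fun_sign (f \o g) = fun_sign f * fun_sign g.
Proof. by rewrite /fun_sign -det_mulmx mul_kernel_fun. Qed.

(** Both sides are multiplicative, so transpositions suffice. *)
Lemma fun_sign_perm (s : {perm V}) : fun_sign s = (-1) ^+ s.
Proof.
have [ts -> dts] := prod_tpermP s.
elim: ts dts => [_|[x y] ts IH /= /andP[xy dts]].
  rewrite big_nil odd_perm1 -[RHS]fun_sign_id.
  by apply: eq_fun_sign => x; rewrite perm1.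
have {}xy : x != y := xy.
rewrite big_cons odd_permM odd_tperm xy signr_addb -IH //.
set t := (\prod_(_ <- _) _)%g.
rewrite mulrC -[_ ^+ true](_ : fun_sign (tperm x y) = _).
  by rewrite -fun_sign_comp; apply: eq_fun_sign => z; rewrite permM.
transitivity (\det (perm_mx (tperm (enum_rank x) (enum_rank y)) : 'M[C]_#|V|)).
  congr (\det _); apply/matrixP=> i j; rewrite !mxE.
  rewrite -(inj_eq enum_val_inj).
  rewrite -[enum_val (tperm _ _ _)](_ : tperm x y (enum_val i) = _).
    by rewrite -(inj_eq (@perm_inj _ (tperm x y))) tpermK.
  rewrite -[x in LHS](enum_rankK) -[y in LHS](enum_rankK).
  by rewrite (inj_tperm _ _ _ (@enum_val_inj _ _)).
by rewrite det_perm odd_tperm (inj_eq enum_rank_inj) xy.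
Qed.

Lemma fun_sign_inj f : injective f -> fun_sign f = 1 \/ fun_sign f = -1.
Proof.
move=> fI; rewrite -(_ : fun_sign (perm fI) = fun_sign f).
  by rewrite fun_sign_perm; case: odd_perm; [right; rewrite expr1 | left].
by apply: eq_fun_sign => x; rewrite permE.
Qed.
End FunSign.

(** * Gauss sums of nondegenerate forms *)

Lemma sum_character (C : numClosedFieldType) (V : finZmodType) (chi : V -> C) :
  {morph chi : x y / x + y >-> x * y} -> (exists z, chi z != 1) ->
  \sum_x chi x = 0.
Proof.
move=> chiD [z chiz]; apply: (@mulfI C (chi z - 1)); first by rewrite subr_eq0.
rewrite mulr0 mulrBl mul1r mulr_sumr; apply/eqP; rewrite subr_eq0; apply/eqP.
rewrite [RHS](reindex_inj (addrI z)) /=.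
by apply: eq_bigr => y _; rewrite chiD.
Qed.

Section Form.
Variables (C : numClosedFieldType) (V : finZmodType).
Hypothesis double_inj : injective (fun x : V => x + x).

(** Otherwise Cauchy's theorem gives an element of order two. *)
Lemma odd_card : odd #|V|.
Proof.
apply/negPn/negP; rewrite -dvdn2 -cardsT => even_V.
have [x _ ox] := @Cauchy V 2 [set: V]%G isT even_V.
have := expg_order x; rewrite ox FinRing.zmodXgE FinRing.zmod1gE mulr2n => xx.
have x0 : x = 0 by apply: double_inj; rewrite xx addr0.
by move: ox; rewrite x0 -FinRing.zmod1gE order1.
Qed.

Definition nondegenerate_form (c : V -> V -> C) : Prop :=
  [/\ forall x y z, c (x + y) z = c x z * c y z,
      forall x y, c x y = c y x,
      forall x y, c x y != 0
    & forall x, x != 0 -> exists y, c x y != 1].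

Definition gauss_sum (c : V -> V -> C) : C := \sum_x c x x.

Section OneForm.
Variables (c : V -> V -> C) (cP : nondegenerate_form c).

Let cDl x y z : c (x + y) z = c x z * c y z. Proof. by have [] := cP. Qed.
Let cC x y : c x y = c y x. Proof. by have [] := cP. Qed.
Let cDr x y z : c x (y + z) = c x y * c x z. Proof. by rewrite cC cDl !(cC x). Qed.
Let c_neq0 x y : c x y != 0. Proof. by have [] := cP. Qed.
Let c0l y : c 0 y = 1.
Proof. by apply: (mulfI (c_neq0 0 y)); rewrite -cDl addr0 mulr1. Qed.
Let cNl x y : c (- x) y = (c x y)^-1.
Proof. by apply: (mulfI (c_neq0 x y)); rewrite -cDl subrr c0l divff. Qed.
Let cNr x y : c x (- y) = (c x y)^-1. Proof. by rewrite cC cNl cC. Qed.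

Lemma sum_form x : \sum_y c x y = (x == 0)%:R * #|V|%:R.
Proof.
case: eqVneq => [->|x0].
  by rewrite mul1r (eq_bigr (fun=> 1)) // sumr_const.
have [_ _ _ nd] := cP; rewrite mul0r; apply: sum_character (nd x x0).
by move=> y z; apply: cDr.
Qed.

Lemma form_mx_sqr :
  kernel_mx c *m kernel_mx c = kernel_mx (fun x y => #|V|%:R * (x == - y)%:R).
Proof.
rewrite mul_kernel_mx; apply: eq_kernel_mx => x z.
under eq_bigr do rewrite (cC _ z) -cDl.
by rewrite sum_form mulrC addr_eq0.
Qed.

Let card_neq0 : #|V|%:R != 0 :> C.
Proof. by rewrite pnatr_eq0 -lt0n; apply/card_gt0P; exists 0. Qed.

Let sign_neg_neq0 : fun_sign C (fun x : V => - x) != 0.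
Proof.
by have [->|->] := fun_sign_inj C (@oppr_inj V); rewrite ?oppr_eq0 oner_eq0.
Qed.

Lemma det_form_neq0 : \det (kernel_mx c) != 0.
Proof.
have : \det (kernel_mx c *m kernel_mx c) != 0.
  rewrite form_mx_sqr.
  rewrite (_ : kernel_mx _ = kernel_mx (fun x y => #|V|%:R * (x == - y)%:R * 1)).
    rewrite (det_kernel_scale (fun=> _) (fun x y => (x == - y)%:R) (fun=> 1)).
    by rewrite !mulf_neq0 //; apply/prodf_neq0 => i _; rewrite ?oner_neq0.
  by apply: eq_kernel_mx => x y; rewrite mulr1.
by rewrite det_mulmx mulf_eq0 negb_or andbb.
Qed.

(** Reindexing the product by doubling raises every factor to the power 4. *)
Lemma cube_prod_form : (\prod_x c x x) ^+ 3 = 1.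
Proof.
set P := \prod_x _.
have P0 : P != 0 by apply/prodf_neq0.
have PP : P = P ^+ 4.
  rewrite {1}/P (reindex_inj double_inj) /P -prodrXl.
  by apply: eq_bigr => x _; rewrite cDl !cDr !exprS expr0 mulr1 !mulrA.
by apply: (mulfI P0); rewrite mulr1 -exprS -PP.
Qed.

(** Completing the square: [c x (2 y) * c y y * c y (2 z)] differs from the
    diagonal value at [x + y + z] by a factor that does not involve [y], so
    summing over [y] produces the Gauss sum; then take determinants. *)
Lemma det_form :
  \det (kernel_mx c) * fun_sign C (fun x : V => x + x) =
  gauss_sum c ^+ #|V| * fun_sign C (fun x : V => - x).
Proof.
set dM := \det _; set sd := fun_sign C _.
pose k x y := c x (y + y).
have dF : \det (kernel_mx k) = dM * sd by rewrite -mul_kernel_fun det_mulmx.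
have dF0 : dM * sd != 0.
  rewrite mulf_neq0 ?det_form_neq0 // /sd.
  by have [->|->] := fun_sign_inj C double_inj; rewrite ?oppr_eq0 oner_eq0.
pose P := \prod_x c x x.
have P0 : P != 0 by apply/prodf_neq0.
have FDF : kernel_mx (fun x y => 1 * k x y * c y y) *m kernel_mx k =
    kernel_mx (fun x z => (gauss_sum c * (c x x)^-1) * k x (- z) * (c z z)^-1).
  rewrite mul_kernel_mx; apply: eq_kernel_mx => x z.
  rewrite /gauss_sum (reindex_inj (addrI (- x - z))) /= !mulr_suml.
  apply: eq_bigr => y _; rewrite /k !(cDl, cDr, cNl, cNr) (cC z x) (cC y x) (cC z y).
  by field; rewrite !c_neq0.
have /(congr1 determinant) := FDF; rewrite det_mulmx.
rewrite (det_kernel_scale (fun=> 1) k (fun y => c y y)).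
rewrite (det_kernel_scale (fun x => gauss_sum c * (c x x)^-1)
  (fun x z => k x (- z)) (fun z => (c z z)^-1)).
rewrite -(mul_kernel_fun k (fun z => - z)) det_mulmx dF.
rewrite big1 // mul1r big_split /= prodr_const !prodfV -/P => h.
have P3 := cube_prod_form; rewrite -/P in P3.
apply: (mulfI dF0); rewrite -[LHS]mulr1 -P3.
transitivity (dM * sd * P * (dM * sd) * P ^+ 2); first by ring.
by rewrite h -/(fun_sign C (fun z : V => - z)); field.
Qed.

End OneForm.

(** The two instances of [det_form] differ only in [det M], which changes by
    the sign of the column permutation [f]. *)
Lemma gauss_sum_comp (c1 c2 : V -> V -> C) (f : V -> V) :
  nondegenerate_form c1 -> nondegenerate_form c2 ->
  (forall x y, c2 x y = c1 x (f y)) ->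
  gauss_sum c2 ^+ #|V| = gauss_sum c1 ^+ #|V| * fun_sign C f.
Proof.
move=> c1P c2P c12.
have sN0 : fun_sign C (fun x : V => - x) != 0.
  by have [->|->] := fun_sign_inj C (@oppr_inj V); rewrite ?oppr_eq0 oner_eq0.
have det12 : \det (kernel_mx c2) = \det (kernel_mx c1) * fun_sign C f.
  rewrite /fun_sign -det_mulmx mul_kernel_fun; congr (\det _).
  exact: eq_kernel_mx.
apply: (mulIf sN0); rewrite -(det_form c2P) det12 mulrAC [RHS]mulrAC.
by rewrite (det_form c1P).
Qed.

(** The quotient is the trace of the normalized Fourier matrix, whose square is
    the matrix of negation. *)
Lemma gauss_sum_gaussian (c : V -> V -> C) (s : nat) :
  nondegenerate_form c -> #|V| = (s ^ 2)%N ->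
  exists a b : int, gauss_sum c / s%:R = a%:~R + 'i * b%:~R.
Proof.
move=> cP Vs.
have s0 : s%:R != 0 :> C.
  rewrite pnatr_eq0; apply/eqP => s0; have := odd_card; by rewrite Vs s0.
pose E := s%:R^-1 *: kernel_mx c.
have EE : E *m E = kernel_mx (fun x y : V => (x == - y)%:R).
  rewrite -scalemxAl -scalemxAr (form_mx_sqr cP) scalerA.
  by apply/matrixP=> i j; rewrite !mxE Vs natrX; field.
have E4 : E ^+ 4 = 1.
  rewrite (exprM _ 2 2) !expr2 -[E * E]/(E *m E) EE.
  rewrite -[_ * _]/(_ *m _) mul_kernel_fun -[RHS]kernel_mx1.
  by apply: eq_kernel_mx => x y; rewrite opprK.
have [a [b ab]] := mxtrace_order4 E4; exists a, b.
by rewrite -ab mxtraceZ mxtrace_kernel mulrC.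
Qed.

(** The sign is known for the [N]-th power of [gauss_sum c2 / s] by comparison
    with [c1]; integrality in [Z[i]] transfers it to the number itself. *)
Lemma gauss_sum_eval (c1 c2 : V -> V -> C) (f : V -> V) (s : nat) :
  nondegenerate_form c1 -> nondegenerate_form c2 ->
  (forall x y, c2 x y = c1 x (f y)) -> injective f ->
  #|V| = (s ^ 2)%N -> gauss_sum c1 = s%:R ->
  gauss_sum c2 = fun_sign C f * s%:R.
Proof.
move=> c1P c2P c12 fI Vs g1.
have s0 : s%:R != 0 :> C.
  rewrite pnatr_eq0; apply/eqP => s0; have := odd_card; by rewrite Vs s0.
have [a [b ab]] := gauss_sum_gaussian c2P Vs.
have uN : (gauss_sum c2 / s%:R) ^+ #|V| = fun_sign C f.
  rewrite expr_div_n (gauss_sum_comp c1P c2P c12) g1.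
  by rewrite mulrAC divff ?mul1r // expf_neq0.
rewrite -uN -(gaussian_unit_odd_power ab odd_card) ?divfK // uN.
exact: fun_sign_inj.
Qed.

End Form.

(** * The sign character computed from a half-system *)

Section HalfSystem.
Variables (V : finZmodType) (H : {set V}).
Hypothesis double_inj : injective (fun x : V => x + x).
Hypothesis H0 : 0 \notin H.
Hypothesis HN : forall v : V, v != 0 -> (- v \in H) = (v \notin H).
Implicit Types s : {perm V}.

Let double0 (v : V) : v + v = 0 -> v = 0.
Proof. by move=> vv; apply: double_inj; rewrite vv addr0. Qed.

Let opp_neq (v : V) : v != 0 -> v != - v.
Proof.
by apply: contra_neq => vN; apply: double0; rewrite {1}vN addNr.
Qed.

Let odd_fix0 s : {morph s : v / - v} -> s 0 = 0.
Proof.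
by move=> sN; apply: double0; rewrite -{1}oppr0 sN addNr.
Qed.

Let neq0_H (v : V) : v \in H -> v != 0.
Proof. by apply: contraTneq => ->. Qed.

(** Such a permutation acts on [H] and on [- H], and its two parts are conjugate
    under negation, so their signs cancel. *)
Lemma odd_perm_half_stable s :
  {morph s : v / - v} -> {in H, forall v, s v \in H} -> ~~ odd_perm s.
Proof.
move=> sN sH; have s0 := odd_fix0 sN.
have sHE v : (s v \in H) = (v \in H).
  apply/idP/idP; last exact: sH.
  apply: contraTT => vH; have [-> | v0] := eqVneq v 0; first by rewrite s0.
  rewrite -HN; last by rewrite -s0 (inj_eq perm_inj).
  by rewrite -sN sH // HN.
pose f v := if v \in H then s v else v.
have fI : injective f.
  move=> u v; rewrite /f; case: ifP => uH; case: ifP => vH //.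
  - exact: perm_inj.
  - by move=> e; rewrite -e sHE uH in vH.
  - by move=> e; rewrite e sHE vH in uH.
pose neg : {perm V} := perm (@oppr_inj V).
pose t : {perm V} := perm fI.
have -> : s = (t * t ^ neg)%g.
  apply/permP=> v; rewrite permM.
  have tneg u : (t ^ neg)%g u = - f (- u).
    by rewrite -{1}[u](_ : neg (- u) = u) ?permJ ?permE ?opprK // permE.
  rewrite tneg permE /f; have [-> | v0] := eqVneq v 0.
    by rewrite (negPf H0) oppr0 (negPf H0) s0 oppr0.
  case: (boolP (v \in H)) => vH.
    rewrite HN; last by rewrite -s0 (inj_eq perm_inj).
    by rewrite sHE vH opprK.
  by rewrite HN // vH sN opprK.
by rewrite odd_permM odd_permJ addbb.
Qed.

(** If [v] in [H] is sent out of [H], composing with the transposition of [v]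
    and [- v] changes the parity and removes [v] from the set on the right. *)
Lemma odd_perm_half s :
  {morph s : v / - v} -> odd_perm s = odd #|[set v in H | s v \notin H]|.
Proof.
have [k] := ubnP #|[set v in H | s v \notin H]|.
elim: k s => // k IH s; rewrite ltnS => cardk sN.
have [A0 | [v]] := set_0Vmem [set v in H | s v \notin H].
  rewrite A0 cards0; apply/negbTE/(odd_perm_half_stable sN) => v vH.
  apply/negPn/negP => svH; have : v \in set0 by rewrite -A0 inE vH.
  by rewrite inE.
rewrite inE => /andP[vH svH]; have v0 := neq0_H vH.
pose t := (tperm v (- v) * s)%g.
have tN : {morph t : u / - u}.
  move=> u; rewrite !permM -sN; congr (s _).
  case: (tpermP v (- v) u) => [->|->|uv uNv].
  - by rewrite opprK tpermR.
  - by rewrite opprK tpermL.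
  by rewrite tpermD // -eqr_opp ?opprK eq_sym; apply/eqP => // /oppr_inj.
have tE : [set u in H | t u \notin H] = [set u in H | s u \notin H] :\ v.
  apply/setP=> u; rewrite !inE permM; case: (tpermP v (- v) u) => [->|->|].
  - rewrite eqxx sN HN ?svH ?andbF //.
    by rewrite -(odd_fix0 sN) (inj_eq perm_inj).
  - by rewrite HN // vH andbF.
  by move=> /eqP->.
have cA : #|[set u in H | s u \notin H]| = #|[set u in H | t u \notin H]|.+1.
  by rewrite tE [LHS](cardsD1 v) inE vH svH.
have st : s = (tperm v (- v) * t)%g by rewrite mulgA tperm2 mul1g.
rewrite cA [in LHS]st odd_permM odd_tperm opp_neq //= IH //.
by rewrite -ltnS -cA ltnS.
Qed.

End HalfSystem.

(** * Signs of matrices over the ring *)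

Section Matrices.
Variables (C : numClosedFieldType) (B : finUnitRingType).
Hypothesis two_unit : (2 : B) \is a GRing.unit.

Lemma double_mx_inj (m n : nat) : injective (fun x : 'M[B]_(m, n) => x + x).
Proof.
move=> x y /matrixP xy; apply/matrixP=> i j; apply: (mulrI two_unit).
by have := xy i j; rewrite !mxE !mulr_natl !mulr2n.
Qed.

Definition mx_sign (m : nat) (Y : 'M[B]_m) : C :=
  fun_sign C (fun v : 'cV[B]_m => Y *m v).

Lemma mx_signM (m : nat) (Y Z : 'M[B]_m) :
  mx_sign (Y *m Z) = mx_sign Y * mx_sign Z.
Proof.
by rewrite -fun_sign_comp; apply: eq_fun_sign => v /=; rewrite mulmxA.
Qed.

Lemma mx_sign1 (m : nat) : mx_sign (1%:M : 'M[B]_m) = 1.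
Proof.
rewrite -(fun_sign_id C 'cV[B]_m).
by apply: eq_fun_sign => v; rewrite mul1mx.
Qed.

Lemma mulmx_inj_of_inverse (m : nat) (Y Z : 'M[B]_m) :
  Z *m Y = 1%:M -> injective (fun v : 'cV[B]_m => Y *m v).
Proof.
move=> ZY u v /= /(congr1 (mulmx Z)).
by rewrite !mulmxA ZY !mul1mx.
Qed.

Lemma mx_sign_sqr (m : nat) (Y Z : 'M[B]_m) :
  Z *m Y = 1%:M -> mx_sign Y ^+ 2 = 1.
Proof.
move=> /mulmx_inj_of_inverse YI; rewrite /mx_sign.
by have [->|->] := fun_sign_inj C YI; rewrite ?sqrrN expr1n.
Qed.

Lemma mu_mx_sign (m : nat) (I : {set 'cV[B]_m}) (Y Z : 'M[B]_m) :
  half_system I -> Z *m Y = 1%:M -> (mu I Y)%:~R = mx_sign Y.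
Proof.
move=> [I0 I1] ZY; have YI := mulmx_inj_of_inverse ZY.
have neqN (v : 'cV[B]_m) : v != 0 -> v != - v.
  apply: contra_neq => vN; apply: double_mx_inj.
  by rewrite {1}vN addNr addr0.
have IN (v : 'cV[B]_m) : v != 0 -> (- v \in I) = (v \notin I).
  move=> v0; have := I1 v v0.
  rewrite (cardsD1 v) (cardsD1 (- v)) !inE !eqxx /= (eq_sym (- v)) (neqN v v0).
  rewrite (_ : _ :\ _ :\ _ = set0) ?cards0.
    by rewrite orbT !andbT; case: (v \in I); case: (- v \in I).
  apply/setP=> u; rewrite !inE; case: (u == v); case: (u == - v) => //=.
  by rewrite andbF.
rewrite /mx_sign -(@eq_fun_sign C _ (perm YI)); last by move=> v; rewrite permE.
rewrite fun_sign_perm (odd_perm_half (@double_mx_inj _ _) I0 IN); last first.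
  by move=> v; rewrite !permE mulmxN.
rewrite signr_odd /mu rmorphXn rmorphN1; congr (_ ^+ _).
apply: eq_card => v; rewrite !inE permE; apply: andb_id2l => vI.
have v0 : v != 0 by apply: contraTneq vI => ->.
have Yv0 : Y *m v != 0 by rewrite -(mulmx0 _ Y) (inj_eq YI).
rewrite -IN //; apply/imsetP/idP => [[w wI ->]|NYv]; first by rewrite opprK.
by exists (- (Y *m v)); rewrite ?opprK.
Qed.

(** The matrix is the square of the unipotent matrix with entry [X / 2]. *)
Lemma mx_sign_upper (n : nat) (X : 'M[B]_n) :
  mx_sign (block_mx 1%:M X 0 1%:M) = 1.
Proof.
pose Y := (2^-1)%:M *m X.
have YY : Y + Y = X.
  by rewrite -mulmxDl -raddfD -mulr2n -[_ *+ 2]mulr_natr mulVr // mul1mx.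
have -> : block_mx 1%:M X 0 1%:M =
    block_mx 1%:M Y 0 1%:M *m block_mx 1%:M Y 0 1%:M.
  by rewrite mulmx_block !(mul1mx, mulmx1, mulmx0, mul0mx, addr0, add0r) YY.
rewrite mx_signM -expr2; apply: (@mx_sign_sqr _ _ (block_mx 1%:M (- Y) 0 1%:M)).
rewrite mulmx_block !(mul1mx, mulmx1, mulmx0, mul0mx, addr0, add0r) subrr.
by rewrite -scalar_mx_block.
Qed.

Lemma mx_sign_lower (n : nat) (X : 'M[B]_n) :
  mx_sign (block_mx 1%:M 0 X 1%:M) = 1.
Proof.
pose S : 'M[B]_(n + n) := block_mx 0 1%:M 1%:M 0.
have SS : S *m S = 1%:M.
  rewrite mulmx_block !(mul1mx, mulmx1, mulmx0, mul0mx, addr0, add0r).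
  by rewrite -scalar_mx_block.
have -> : block_mx 1%:M 0 X 1%:M = S *m block_mx 1%:M X 0 1%:M *m S.
  by rewrite !mulmx_block !(mul1mx, mulmx1, mulmx0, mul0mx, addr0, add0r).
by rewrite !mx_signM mx_sign_upper mulr1 -expr2 (mx_sign_sqr SS).
Qed.

Definition symplectic_mx (n : nat) : 'M[B]_(n + n) :=
  block_mx 0 1%:M (- 1%:M) 0.

Lemma symplectic_mx_sqr n : symplectic_mx n *m symplectic_mx n = - 1%:M.
Proof.
rewrite mulmx_block !(mul1mx, mulmx1, mulmx0, mul0mx, addr0, add0r).
by rewrite (scalar_mx_block n n) opp_block_mx !oppr0.
Qed.

Lemma mx_sign_symplectic n : mx_sign (symplectic_mx n) = 1.
Proof.
(* The usual factorization of a quarter turn into three shears. *)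
have -> : symplectic_mx n = block_mx 1%:M 1%:M 0 1%:M *m
    block_mx 1%:M 0 (- 1%:M) 1%:M *m block_mx 1%:M 1%:M 0 1%:M.
  rewrite !mulmx_block !(mul1mx, mulmx1, mulmx0, mul0mx, addr0, add0r).
  by rewrite subrr addNr add0r.
by rewrite !mx_signM mx_sign_upper mx_sign_lower !mulr1.
Qed.

Lemma mx_signN n (Y : 'M[B]_(n + n)) : mx_sign (- Y) = mx_sign Y.
Proof.
rewrite -[Y in LHS]mul1mx -mulNmx -symplectic_mx_sqr !mx_signM mx_sign_symplectic.
by rewrite !mul1r.
Qed.

End Matrices.

(** * The forms attached to skew matrices *)

Section SkewForms.
Variables (C : numClosedFieldType) (B : finUnitRingType).
Variables (star : B -> B) (beta : B -> C).
Hypothesis two_unit : (2 : B) \is a GRing.unit.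
Hypothesis star_inv : ring_involution star.
Hypothesis beta_char : additive_character beta.
Hypothesis beta_prim : primitive_character beta.
Hypothesis beta_star : forall b : B, beta (b + star b) = 1.

Let starD : {morph star : x y / x + y}. Proof. by case: star_inv. Qed.
Let starM : {morph star : x y / x * y >-> y * x}. Proof. by case: star_inv. Qed.
Let starK : involutive star. Proof. by case: star_inv. Qed.
Let star0 : star 0 = 0.
Proof. by apply: (addrI (star 0)); rewrite -starD !addr0. Qed.
Let starN : {morph star : x / - x}.
Proof. by move=> x; apply: (addrI (star x)); rewrite -starD !subrr star0. Qed.
Let star1 : star 1 = 1.
Proof. by rewrite -[LHS]mul1r -{1}(starK 1) -starM mul1r starK. Qed.

Let betaD : {morph beta : x y / x + y >-> x * y}. Proof. by case: beta_char. Qed.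
Let beta_neq0 b : beta b != 0.
Proof. by have [/(_ b)] := beta_char; rewrite unitfE. Qed.
Let beta0 : beta 0 = 1.
Proof. by apply: (mulfI (beta_neq0 0)); rewrite -betaD addr0 mulr1. Qed.

Lemma beta_skew b : beta (- star b) = beta b.
Proof.
apply: (mulIf (beta_neq0 (star b))).
by rewrite -!betaD addNr beta_star beta0.
Qed.

Lemma star_mxE (m n : nat) (A : 'M[B]_(m, n)) : star_mx star A = map_mx star A^T.
Proof. by apply/matrixP=> i j; rewrite !mxE. Qed.

Lemma star_mxD (m n : nat) : {morph @star_mx B star m n : x y / x + y}.
Proof. by move=> x y; apply/matrixP=> i j; rewrite !mxE starD. Qed.

Lemma star_mxK (m n : nat) (A : 'M[B]_(m, n)) : star_mx star (star_mx star A) = A.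
Proof. by apply/matrixP=> i j; rewrite !mxE starK. Qed.

Lemma star_mx0 (m n : nat) : star_mx star (0 : 'M[B]_(m, n)) = 0.
Proof. by apply/matrixP=> i j; rewrite !mxE star0. Qed.

Lemma star_mxM (m n p : nat) (A : 'M[B]_(m, n)) (D : 'M[B]_(n, p)) :
  star_mx star (A *m D) = star_mx star D *m star_mx star A.
Proof.
apply/matrixP=> i j; rewrite !mxE (big_morph _ starD star0).
by apply: eq_bigr => k _; rewrite starM !mxE.
Qed.

Definition sesqui_form (m : nat) (T : 'M[B]_m) (x y : 'cV[B]_m) : C :=
  beta ((star_mx star x *m T *m y) 0 0).

Lemma sesqui_formDr m (T : 'M[B]_m) x :
  {morph sesqui_form T x : y z / y + z >-> y * z}.
Proof. by move=> y z; rewrite /sesqui_form mulmxDr mxE betaD. Qed.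

Lemma mulmx_scale_delta m (w : 'rV[B]_m) j b :
  (w *m (b *: delta_mx j 0)) 0 (0 : 'I_1) = w 0 j * b.
Proof.
rewrite mxE (bigD1 j) //= !mxE !eqxx mulr1 big1 ?addr0 // => k /negPf kj.
by rewrite !mxE kj mulr0 mulr0.
Qed.

(** If [sesqui_form T x] were trivial, the right ideals generated by the entries
    of [x^* T] would lie in the kernel of [beta], forcing [x^* T = 0]. *)
Lemma sesqui_form_nondegenerate m (T Tinv : 'M[B]_m) (x : 'cV[B]_m) :
  T *m Tinv = 1%:M -> x != 0 -> exists y, sesqui_form T x y != 1.
Proof.
move=> TT x0; apply/existsP; apply: contraNT x0 => /existsPn triv.
pose w := star_mx star x *m T.
have w0 j : w 0 j = 0.
  pose J := [set w 0 j * b | b : B].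
  have J0 : J = [set 0].
    apply: beta_prim.
      split; first by apply/imsetP; exists 0; rewrite ?mulr0.
        move=> _ _ /imsetP[a _ ->] /imsetP[b _ ->].
        by apply/imsetP; exists (a - b); rewrite ?mulrBr.
      move=> _ b /imsetP[a _ ->].
      by apply/imsetP; exists (a * b); rewrite ?mulrA.
    move=> _ /imsetP[b _ ->]; rewrite -mulmx_scale_delta.
    by have /negPn/eqP := triv (b *: delta_mx j 0).
  have : w 0 j \in J by apply/imsetP; exists 1; rewrite ?mulr1.
  by rewrite J0 inE => /eqP.
have {}w0 : w = 0 by apply/rowP=> j; rewrite w0 mxE.
have : star_mx star x = 0 by rewrite -[LHS]mulmx1 -TT mulmxA -/w w0 mul0mx.
by move=> sx0; rewrite -[x]star_mxK sx0 star_mx0.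
Qed.

Lemma skew_form_nondegenerate m (T Tinv : 'M[B]_m) :
  T *m Tinv = 1%:M -> star_mx star T = - T ->
  nondegenerate_form (sesqui_form T).
Proof.
move=> TT T_skew; split => [x y z|x y|x y|x].
- by rewrite /sesqui_form star_mxD !mulmxDl mxE betaD.
- rewrite /sesqui_form -beta_skew; congr beta.
  transitivity (- star_mx star (star_mx star x *m T *m y) 0 0).
    by rewrite [in RHS]mxE.
  by rewrite !star_mxM star_mxK T_skew mulNmx mulmxN mulmxA mxE opprK.
- exact: beta_neq0.
- exact: sesqui_form_nondegenerate TT.
Qed.

Lemma symplectic_mx_skew n : star_mx star (symplectic_mx B n) = - symplectic_mx B n.
Proof.
apply/matrixP=> i j; rewrite star_mxE tr_block_mx !trmx0 linearN /= trmx1.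
rewrite opp_block_mx opprK !oppr0 !mxE.
case: split => k; rewrite !mxE; case: split => l; rewrite !mxE ?star0 //.
  by rewrite starN; case: eqP; rewrite ?star1 ?star0.
by case: eqP; rewrite ?star1 ?star0.
Qed.

(** For [x = (p, q)] the two halves of [x^* J x] contribute the same value, so
    the summand is [beta (2 p^* q)]; its sum over [q] vanishes unless [p = 0]. *)
Lemma gauss_sum_symplectic n :
  gauss_sum (sesqui_form (symplectic_mx B n)) = (#|B| ^ n)%:R.
Proof.
rewrite /gauss_sum.
pose h (u : 'cV[B]_n * 'cV[B]_n) := col_mx u.1 u.2.
have h_bij : bijective h.
  exists (fun v => (usubmx v, dsubmx v)) => [[p q]|v].
    by rewrite /h col_mxKu col_mxKd.
  by rewrite /h vsubmxK.
rewrite (reindex h) /=; last exact: onW_bij.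
pose F (p q : 'cV[B]_n) := sesqui_form 1%:M p (q + q).
rewrite (eq_bigr (fun u => F u.1 u.2)); last first.
  move=> [p q] _; rewrite /F /sesqui_form /h /= star_mxE tr_col_mx map_row_mx.
  rewrite -!star_mxE mul_row_block mul_row_col !mulmx0 add0r addr0 !mulmx1.
  rewrite mulmxN mulmx1 mulNmx mulmxDr !mxE !betaD; congr (_ * _).
  have /matrixP/(_ 0 0) := star_mxM (star_mx star p) q.
  by rewrite star_mxK !mxE => sw; rewrite -[RHS]beta_skew sw.
rewrite -(pair_bigA _ F) /= (bigD1 0) //= [X in _ + X]big1 => [|p p0].
  rewrite addr0 (eq_bigr (fun=> 1)) ?sumr_const ?card_mx ?muln1 //.
  by move=> q _; rewrite /F /sesqui_form star_mx0 !mul0mx mxE beta0.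
transitivity (\sum_q sesqui_form 1%:M p q).
  by rewrite [RHS](reindex_inj (@double_mx_inj B two_unit n 1)).
apply: sum_character; first exact: sesqui_formDr.
exact: sesqui_form_nondegenerate (mulmx1 _) p0.
Qed.

(** Comparison of the form of [T] with the form of [J] along [- J T = J^-1 T]. *)
Lemma gauss_sum_skew n (T Tinv : 'M[B]_(n + n)) :
  mutually_inverse_mx T Tinv -> star_mx star T = - T ->
  gauss_sum (sesqui_form T) = mx_sign C T * #|B|%:R ^+ n.
Proof.
move=> [TT' T'T] T_skew; set J := symplectic_mx B n.
have JN : J *m (- J) = 1%:M by rewrite mulmxN symplectic_mx_sqr opprK.
have NJ : (- J) *m J = 1%:M by rewrite mulNmx symplectic_mx_sqr opprK.
have -> : mx_sign C T = mx_sign C (- J *m T).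
  by rewrite mx_signM mx_signN // mx_sign_symplectic // mul1r.
rewrite -natrX; apply: (@gauss_sum_eval C _ _ (sesqui_form J)).
- exact: double_mx_inj.
- exact: skew_form_nondegenerate JN (symplectic_mx_skew n).
- exact: skew_form_nondegenerate TT' T_skew.
- by move=> x y; rewrite /sesqui_form !mulmxA -(mulmxA _ J) JN mulmx1.
- apply: (@mulmx_inj_of_inverse _ _ _ (Tinv *m J)).
  by rewrite mulmxA -(mulmxA Tinv) JN mulmx1.
- by rewrite card_mx muln1 addnn -muln2 expnM.
- exact: gauss_sum_symplectic.
Qed.
End SkewForms.

Theorem theorem11p2 (R : realType) (B : finUnitRingType)
  (two_unit : (2 : B) \is a GRing.unit)
  (star : B -> B) (star_inv : ring_involution star)
  (beta : B -> R[i]) (beta_char : additive_character beta)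
  (beta_prim : primitive_character beta)
  (beta_star : forall b : B, beta (b + star b) = 1)
  (m n : nat) (m_even : m = (2 * n)%N) (m_ge2 : (2 <= m)%N)
  (I : {set 'cV[B]_m}) (I_half : half_system I)
  (T Tinv : 'M[B]_m) (T_GL : mutually_inverse_mx T Tinv)
  (T_skew : star_mx star T = - T) :
  \sum_(b : 'cV[B]_m) beta ((star_mx star b *m T *m b) 0 0)
    = (mu I (- Tinv))%:~R * (#|B|%:R) ^+ n
  /\ (mu I (- Tinv))%:~R * (#|B|%:R) ^+ n
    = (mu I T)%:~R * (#|B|%:R) ^+ n :> R[i].
Proof.
have m_nn : m = (n + n)%N by rewrite m_even mul2n addnn.
move: {m_even m_ge2} I I_half T Tinv T_GL T_skew; rewrite m_nn => {m m_nn}.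
move=> I I_half T Tinv T_GL T_skew; have [TT' T'T] := T_GL.
have NN : - T *m - Tinv = 1%:M by rewrite mulNmx mulmxN opprK.
have signE : mx_sign R[i] Tinv = mx_sign R[i] T.
  rewrite -[LHS]mul1r -(mx_sign_sqr _ T'T) expr2 -mulrA -mx_signM TT'.
  by rewrite mx_sign1 mulr1.
rewrite (mu_mx_sign _ two_unit I_half NN) (mu_mx_sign _ two_unit I_half T'T).
rewrite (mx_signN _ two_unit) signE; split; last by [].
exact: gauss_sum_skew T_GL T_skew.
Qed.
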